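(* Let $A$ be a commutative ring with $\mathrm{Hdim}\,A<k$, let $M$ be a finitely generated projective $A$-module of rank $\ge k$, and let $N,Q$ be two finitely generated projective $A$-modules. Then $M\oplus Q\simeq N\oplus Q$ implies $M\simeq N$.
   Context: For a commutative ring $A$, let $\mathrm{J}_A(0)=\{x\in A:\forall y\in A,\ 1+xy \text{ is invertible}\}$ be its Jacobson radical, and for $x\in A$ let $\mathrm{H}_A(x)=xA+(\mathrm{J}_A(0):x)$ (Heitmann boundary ideal), where $(\mathrm{J}_A(0):x)=\{b\in A: bx\in \mathrm{J}_A(0)\}$. The Heitmann dimension is defined inductively: $\mathrm{Hdim}\,A\le -1$ iff $1=0$ in $A$; for $\ell\ge 0$, $\mathrm{Hdim}\,A\le \ell$ iff $\mathrm{Hdim}(A/\mathrm{H}_A(x))\le\ell-1$ for all $x\in A$. $\mathrm{Hdim}\,A<k$ means $\mathrm{Hdim}\,A\le k-1$. A finitely generated projective module has rank $\ge k$ if its rank at every prime ideal is $\ge k$; equivalently, if $F$ is an idempotent matrix with image isomorphic to it, the minors of order $k$ of $F$ generate the unit ideal. No noetherian hypothesis is made. *)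

(* Defs.v *)
From HB Require Import structures.
From mathcomp Require Import all_boot all_algebra.
From mathcomp Require Import generic_quotient ring_quotient.
From mathcomp Require Import boolp.
From mathcomp Require Import ring.

Set Implicit Arguments.
Unset Strict Implicit.
Unset Printing Implicit Defensive.

Import GRing.Theory.
Local Open Scope ring_scope.
Local Open Scope quotient_scope.

(* Commutative rings are [comPzRingType]s: the zero ring must be allowed, since
   it is the base case of the Heitmann dimension. *)

Section Ideals.
Variable A : comPzRingType.

Definition invertible (a : A) : Prop := exists b, a * b = 1.

Record is_ideal (I : A -> Prop) : Prop := IsIdeal {
  ideal0 : I 0;
  idealD : forall a b, I a -> I b -> I (a + b);
  idealM : forall a b, I b -> I (a * b) }.

Record is_prime_ideal (p : A -> Prop) : Prop := IsPrimeIdeal {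
  prime_is_ideal : is_ideal p;
  prime_proper : ~ p 1;
  primeM : forall a b, p (a * b) -> p a \/ p b }.

Definition jacobson (x : A) : Prop := forall y, invertible (1 + x * y).

Definition heitmann (x a : A) : Prop :=
  exists y b, jacobson (b * x) /\ a = x * y + b.

Lemma jacobson_ideal : is_ideal jacobson.
Proof.
split.
- by move=> y; exists 1; rewrite mul0r addr0 mulr1.
- move=> a b Ja Jb y.
  have [u Hu] := Ja y; have [v Hv] := Jb (y * u).
  exists (u * v).
  have -> : 1 + (a + b) * y = (1 + a * y) * (1 + b * (y * u)).
    rewrite mulrDr mulr1.
    have -> : (1 + a * y) * (b * (y * u)) = (1 + a * y) * u * (b * y) by ring.
    by rewrite Hu mul1r mulrDl addrA.
  by rewrite mulrACA Hu Hv mulr1.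
- move=> a b Jb y; have [u Hu] := Jb (a * y).
  by exists u; rewrite -[RHS]Hu; ring.
Qed.

Lemma heitmann_ideal x : is_ideal (heitmann x).
Proof.
have [J0 JD JM] := jacobson_ideal.
split.
- by exists 0, 0; rewrite mul0r; split=> //; ring.
- move=> _ _ [y [b [Jb ->]]] [z [c [Jc ->]]].
  by exists (y + z), (b + c); rewrite mulrDl; split; [exact: JD|ring].
- move=> a _ [y [b [Jb ->]]].
  by exists (a * y), (a * b); rewrite -mulrA; split; [exact: JM|ring].
Qed.

End Ideals.

(* The quotient ring A / I. The construction {ideal_quot _} of ring_quotient
   only covers proper ideals of nontrivial rings, so the ring structure is
   rebuilt here on top of the quotient of additive groups. *)
Section QuotientRing.
Variables (A : comPzRingType) (I : A -> Prop) (idI : is_ideal I).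

Definition ideal_pred : A -> bool := fun a => `[< I a >].

Lemma ideal_pred_zmod_closed : zmod_closed ideal_pred.
Proof.
have [I0 ID IM] := idI.
split=> [|a b /asboolP Ia /asboolP Ib]; apply/asboolP => //.
by apply: ID => //; rewrite -mulN1r; apply: IM.
Qed.

Definition ideal_zmod : zmodClosed A := HB.pack ideal_pred
  (GRing.isZmodClosed.Build A ideal_pred ideal_pred_zmod_closed).

Definition quotient_ring := Quotient.quot ideal_zmod.

HB.instance Definition _ := GRing.Zmodule.on quotient_ring.
HB.instance Definition _ := EqQuotient.on quotient_ring.

Definition qproj (a : A) : quotient_ring := \pi_quotient_ring a.

Lemma qprojP a b : qproj a = qproj b <-> I (a - b).
Proof.
rewrite /qproj; split.
  by move/eqP; rewrite -[_ == _]Quotient.idealrBE => /asboolP.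
by move=> H; apply/eqP; rewrite -[_ == _]Quotient.idealrBE; apply/asboolP.
Qed.

Lemma qproj_repr (u : quotient_ring) : qproj (repr u) = u.
Proof. exact: reprK. Qed.

Lemma qprojD a b : qproj (a + b) = qproj a + qproj b.
Proof. by rewrite /qproj -[LHS]/(\pi_(Quotient.quot ideal_zmod) (a + b)) !piE. Qed.

Definition qone : quotient_ring := qproj 1.
Definition qmul (u v : quotient_ring) : quotient_ring :=
  qproj (repr u * repr v).

Lemma qprojM a b : qproj (a * b) = qmul (qproj a) (qproj b).
Proof.
have [I0 ID IM] := idI.
have Ir c : I (c - repr (qproj c)) by apply/qprojP; rewrite qproj_repr.
apply/qprojP.
have -> : a * b - repr (qproj a) * repr (qproj b) =
  b * (a - repr (qproj a)) + repr (qproj a) * (b - repr (qproj b)) by ring.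
by apply: ID; apply: IM; apply: Ir.
Qed.

Lemma qmulA : associative qmul.
Proof.
by move=> u v w; rewrite -[u]qproj_repr -[v]qproj_repr -[w]qproj_repr
  -!qprojM mulrA.
Qed.

Lemma qmulC : commutative qmul.
Proof. by move=> u v; rewrite /qmul mulrC. Qed.

Lemma qmul1 : left_id qone qmul.
Proof. by move=> u; rewrite -[u]qproj_repr -qprojM mul1r. Qed.

Lemma qmulDl : left_distributive qmul +%R.
Proof.
by move=> u v w; rewrite -[u]qproj_repr -[v]qproj_repr -[w]qproj_repr
  -qprojD -!qprojM -qprojD mulrDl.
Qed.

Lemma qmul0 : left_zero 0 qmul.
Proof. by move=> u; apply: (addrI (qmul 0 u)); rewrite -qmulDl !addr0. Qed.

HB.instance Definition _ := GRing.Zmodule_isComPzRing.Build quotient_ring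
  qmulA qmulC qmul1 qmulDl.

End QuotientRing.

(* [Hdim_lt k A] is Hdim A < k, that is Hdim A <= k - 1. *)
Fixpoint Hdim_lt (k : nat) (A : comPzRingType) : Prop :=
  match k with
  | 0 => 1 = 0 :> A
  | l.+1 => forall x : A, Hdim_lt l (quotient_ring (heitmann_ideal x))
  end.

Section Modules.
Variable A : comPzRingType.

Definition lmod_iso (M N : lmodType A) : Prop :=
  exists f : {linear M -> N}, bijective f.

Definition finitely_generated (M : lmodType A) : Prop :=
  exists n (e : 'I_n -> M), forall m, exists c : 'I_n -> A,
    m = \sum_(i < n) c i *: e i.

Definition projective (M : lmodType A) : Prop :=
  forall (X Y : lmodType A) (g : {linear X -> Y}) (f : {linear M -> Y}),
    (forall y, exists x, g x = y) ->
    exists h : {linear M -> X}, forall m, g (h m) = f m.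

Definition fg_projective (M : lmodType A) : Prop :=
  finitely_generated M /\ projective M.

(* [rank_at p M r]: the localization of M at the prime ideal p is free of
   rank r. Up to units of the localization of A, a basis can be taken of the
   form e_1/1, ..., e_r/1 with e_i in M; the two clauses say, after clearing
   denominators, that these fractions generate M_p and that they are linearly
   independent over A_p. *)
Definition rank_at (p : A -> Prop) (M : lmodType A) (r : nat) : Prop :=
  exists e : 'I_r -> M,
    (forall m, exists s (c : 'I_r -> A),
       ~ p s /\ s *: m = \sum_(i < r) c i *: e i) /\
    (forall (c : 'I_r -> A) s,
       ~ p s -> s *: (\sum_(i < r) c i *: e i) = 0 ->
       forall i, exists2 t, ~ p t & t * c i = 0).

Definition rank_ge (k : nat) (M : lmodType A) : Prop :=
  forall p, is_prime_ideal p -> exists2 r, rank_at p M r & (k <= r)%N.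

End Modules.

(* Main.v *)
Require Import Defs.
From HB Require Import structures.
From mathcomp Require Import all_boot all_algebra.
From mathcomp Require Import boolp classical_sets.
From mathcomp Require Import ring.
Import GRing.Theory.

(** The proof is Bass cancellation, with the noetherian dimension argument
    replaced by an induction on the Heitmann dimension.

    Reduction to a unimodularity statement. If Q is a retract of A^q, then an
    isomorphism between M + Q and N + Q extends to one between M + A^q and
    N + A^q ([lmod_iso_free]), and copies of A can be cancelled one at a time.
    Let f be an isomorphism from M + A to N + A, and let (m, b) be the preimage
    of (0, 1), so that the forms on M, evaluated at m, and b generate the unit
    ideal. If some m + b w is unimodular in M, then elementary automorphisms of
    M + A carry (m, b) to (0, 1); f may then be assumed to fix (0, 1), and
    dividing by that line gives an isomorphism from M to N ([cancel_line]).

    Finding w ([unimodular_shift]). Call a an element at which M splits off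
    rank k when there are e_1, ..., e_k in M and forms phi_1, ..., phi_k with
    phi_i(e_j) = a delta_ij; after inverting a, this is a free summand of rank k.
    If M has rank at least k at a prime p, such an a exists outside p, so these
    elements generate the unit ideal ([rank_ge_locally_splits]), and 1 is a
    finite sum of them. Each term of the sum is dealt with in turn by
    [comaximal_perturb], the only place where the dimension is used.

    The induction ([comaximal_perturb]). Let c be a vector, dual families
    phi_i(g_j) = a delta_ij for i, j <= k, and suppose that the coordinates of c
    together with a + e generate the unit ideal. A combination
    c + a (t_1 g_1 + ... + t_k g_k) is wanted which is comaximal with e.
    Put x = phi_k(c). Modulo the boundary ideal of x the dimension drops, so
    t_1, ..., t_(k-1) exist giving a vector c', with
    1 = l + v e + x y + b, where l is a combination of the coordinates of c' and
    b x lies in the Jacobson radical; moreover phi_k(c') = x. Then t_k = b works.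
    Indeed, suppose that c' + a b g_k and e vanish modulo a prime containing the
    Jacobson radical. Applying phi_k gives x + a^2 b = 0, and with b x = 0 this
    makes x and a b vanish. Hence c' vanishes, so b = 1 and a = 0; but then
    c = c' and a + e vanish together, contrary to the hypothesis. *)

Set Implicit Arguments.
Unset Strict Implicit.
Unset Printing Implicit Defensive.

Local Open Scope ring_scope.

(** * Maximal and prime ideals *)

Section Ideals.
Variable A : comPzRingType.
Implicit Types I m : A -> Prop.

(** Zorn's lemma is applied to the sets X for which the union of I and X is a
    proper ideal, rather than to the proper ideals containing I: the union of
    the empty chain is then no exception. *)
Lemma maximal_ideal_exists I : is_ideal I -> ~ I 1 ->
  exists m, [/\ is_ideal m, ~ m 1, forall x, I x -> m x
    & forall x, ~ m x -> exists y, m (1 - x * y)].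
Proof.
move=> idI I1.
pose P (X : set A) := is_ideal (fun x => I x \/ X x) /\ ~ X 1.
have [F FP Ftot|M [[idM M1] Mmax]] := @Zorn_bigcup A P.
  split; last by case=> X /FP[].
  split.
  - by left; apply: (ideal0 idI).
  - have sym (X : set A) x y : F X -> I x \/ X x -> I y \/ X y ->
        I (x + y) \/ (\bigcup_(X in F) X)%classic (x + y).
      move=> FX Xx Xy; have [idX _] := FP _ FX.
      by have [|Xxy] := idealD idX Xx Xy; [left|right; exists X].
    move=> x y [Ix|[X FX Xx]] [Iy|[Y FY Yy]].
    + by left; apply: (idealD idI).
    + by apply: (sym Y) => //; [left|right].
    + by apply: (sym X) => //; [right|left].
    + have [XY|YX] := Ftot _ _ FX FY.
      * by apply: (sym Y) => //; right=> //; apply: XY.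
      * by apply: (sym X) => //; right=> //; apply: YX.
  - move=> x y [Iy|[X FX Xy]]; first by left; apply: (idealM idI).
    have [idX _] := FP _ FX.
    by have [|Xxy] := idealM idX x (or_intror Xy); [left|right; exists X].
exists (fun x => I x \/ M x); split=> // [[]//|x Ix|x Mx]; first by left.
(* B is the ideal generated by the maximal one and x. *)
pose B : set A := fun z => exists2 y, I y \/ M y & exists w, z = y + x * w.
have IB z : I z \/ M z -> B z.
  by move=> Mz; exists z => //; exists 0; rewrite mulr0 addr0.
have [[y My [w e1]]|B1] := pselect (B 1).
  by exists w; rewrite e1 addrK.
case: (Mmax B).
  split; first by move=> z Mz; apply: IB; right.
  move=> BM; apply: Mx; right; apply: BM.
  by exists 0; [left; apply: (ideal0 idI)|exists 1; rewrite mulr1 add0r].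
split=> //.
have -> : (fun z => I z \/ B z) = B.
  by apply/predeqP => z; split=> [[Iz|//]|]; [apply: IB; left|right].
split.
- by apply: IB; left; apply: (ideal0 idI).
- move=> _ _ [y My [w ->]] [z Mz [v ->]].
  by exists (y + z); [apply: (idealD idM)|exists (w + v); ring].
- move=> a _ [y My [w ->]].
  by exists (a * y); [apply: (idealM idM)|exists (a * w); ring].
Qed.

(** A maximal ideal is prime and contains the Jacobson radical. *)
Lemma prime_ideal_exists I : is_ideal I -> ~ I 1 ->
  exists m, [/\ is_prime_ideal m, forall x, jacobson x -> m x
    & forall x, I x -> m x].
Proof.
move=> idI I1; have [m [idm m1 Im mmax]] := maximal_ideal_exists idI I1.
exists m; split=> //.
  split=> // a b mab; apply: contrapT => /not_orP[ma mb].
  have [y my] := mmax _ ma; apply: mb.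
  have -> : b = b * (1 - a * y) + y * (a * b) by ring.
  by apply: (idealD idm); apply: (idealM idm).
move=> x Jx; apply: contrapT => mx; have [y my] := mmax _ mx.
have [z e1] := Jx (- y); apply: m1.
by rewrite -e1 mulrN mulrC; apply: (idealM idm).
Qed.

End Ideals.

(** * Comaximality *)

Section Quotient.
Variables (A : comPzRingType) (I : A -> Prop) (idI : is_ideal I).

Lemma qproj_is_zmod_morphism : zmod_morphism (qproj idI).
Proof.
move=> a b; apply: (addIr (qproj idI b)).
by rewrite -qprojD !subrK.
Qed.

Lemma qproj_is_monoid_morphism : monoid_morphism (qproj idI).
Proof. by split=> // a b; rewrite qprojM. Qed.

HB.instance Definition _ := GRing.isZmodMorphism.Build A (quotient_ring idI)
  (qproj idI) qproj_is_zmod_morphism.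
HB.instance Definition _ := GRing.isMonoidMorphism.Build A (quotient_ring idI)
  (qproj idI) qproj_is_monoid_morphism.

End Quotient.

Section Comaximal.
Variable A : comPzRingType.

Definition comaximal n (c : 'cV[A]_n) (e : A) : Prop :=
  exists (u : 'rV[A]_n) v, (u *m c) 0 0 + v * e = 1.

(** Comaximality may be tested at the primes containing the Jacobson radical,
    which allows elements of the radical to be treated as zero. *)
Lemma comaximal_prime n (c : 'cV[A]_n) e :
  (forall p, is_prime_ideal p -> (forall x, jacobson x -> p x) ->
     (forall u : 'rV_n, p ((u *m c) 0 0)) -> p e -> False) ->
  comaximal c e.
Proof.
move=> H; pose I x := exists (u : 'rV[A]_n) v, (u *m c) 0 0 + v * e = x.
apply: (contrapT (P := I 1)) => I1.
have idI : is_ideal I.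
  split.
  - by exists 0, 0; rewrite mul0mx mxE mul0r addr0.
  - move=> _ _ [u [v <-]] [u' [v' <-]]; exists (u + u'), (v + v').
    by rewrite mulmxDl !mxE mulrDl; ring.
  - move=> a _ [u [v <-]]; exists (a *: u), (a * v).
    by rewrite -scalemxAl [in LHS]mxE mulrDr mulrA.
have [p [pp Jp Ip]] := prime_ideal_exists idI I1.
apply: (H p pp Jp) => [u|]; apply: Ip.
  by exists u, 0; rewrite mul0r addr0.
by exists 0, 1; rewrite mul0mx mxE mul1r add0r.
Qed.

End Comaximal.

Lemma comaximal_quotient (A : comPzRingType) (x : A) n (c : 'cV[A]_n) e :
  comaximal (map_mx (qproj (heitmann_ideal x)) c) (qproj (heitmann_ideal x) e) ->
  exists (u : 'rV[A]_n) v y b, jacobson (b * x) /\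
     (u *m c) 0 0 + v * e + (x * y + b) = 1.
Proof.
set q := qproj _ => -[u [v]].
pose u' := map_mx repr u; have -> : u = map_mx q u'.
  by apply/matrixP=> i j; rewrite !mxE [RHS]qproj_repr.
have -> : v = q (repr v) by rewrite [RHS]qproj_repr.
rewrite -map_mxM mxE -rmorphM -rmorphD -(rmorph1 q).
move=> /esym/qprojP[y [b [Jb e1]]].
by exists u', (repr v), y, b; split=> //; rewrite -e1 addrC subrK.
Qed.

Lemma comaximal_map (A B : comPzRingType) (f : {rmorphism A -> B})
    n (c : 'cV[A]_n) e :
  comaximal c e -> comaximal (map_mx f c) (f e).
Proof.
move=> [u [v e1]]; exists (map_mx f u), (f v).
by rewrite -map_mxM mxE -rmorphM -rmorphD e1 rmorph1.
Qed.

Lemma mulmx_shift (A : comPzRingType) n (u : 'rV[A]_n) (c g : 'cV[A]_n) a :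
  (u *m (c + a *: g)) 0 0 = (u *m c) 0 0 + a * (u *m g) 0 0.
Proof. by rewrite mulmxDr -scalemxAr [LHS]mxE [X in _ + X]mxE. Qed.

(** The induction on the Heitmann dimension. The element e is what makes the
    lemma iterable: it stands for the part of a sum of elements a which has
    still to be dealt with. The factor a in the perturbation leaves c unchanged
    where a vanishes. *)
Lemma comaximal_perturb k : forall (A : comPzRingType), Hdim_lt k A ->
  forall n (c : 'cV[A]_n) (a e : A) (g : nat -> 'cV[A]_n) (phi : nat -> 'rV[A]_n),
  (forall i j, (i < k)%N -> (j < k)%N -> (phi i *m g j) 0 0 = a *+ (i == j)) ->
  comaximal c (a + e) ->
  exists t : nat -> A, comaximal (c + a *: \sum_(i < k) t i *: g i) e.
Proof.
elim: k => [|k IHk] A hA n c a e g phi dual cae.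
  exists (fun=> 0), 0, 0.
  by rewrite mul0mx mxE mul0r addr0 (hA : 1 = 0 :> A).
pose x := (phi k *m c) 0 0.
pose q : {rmorphism A -> _} := qproj (heitmann_ideal x).
have [||s] := IHk _ (hA x) n (map_mx q c) (q a) (q e)
  (fun i => map_mx q (g i)) (fun i => map_mx q (phi i)).
- move=> i j ik jk; rewrite -map_mxM mxE dual ?rmorphMn //; exact: ltnW.
- by rewrite -rmorphD; apply: comaximal_map.
pose t i := repr (s i).
have -> : map_mx q c + q a *: (\sum_(i < k) s i *: map_mx q (g i))
    = map_mx q (c + a *: \sum_(i < k) t i *: g i).
  rewrite map_mxD map_mxZ; congr (_ + (_ *: _)).
  rewrite raddf_sum; apply: eq_bigr => i _.
  by rewrite [RHS]map_mxZ; congr (_ *: _); rewrite [RHS]qproj_repr.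
set c' := c + _ => /comaximal_quotient[u [v [y [b [Jbx e1]]]]].
(* The last coefficient b vanishes wherever x does not. *)
exists (fun i => if i == k then b else t i).
have -> : c + a *: \sum_(i < k.+1)
    (if nat_of_ord i == k then b else t i) *: g i = c' + (a * b) *: g k.
  rewrite big_ord_recr /= eqxx scalerDr addrA scalerA; congr (c + a *: _ + _).
  by apply: eq_bigr => i _; rewrite ltn_eqF.
(* The vectors g_i with i < k are orthogonal to phi_k. *)
have phic' : (phi k *m c') 0 0 = x.
  rewrite mulmx_shift mulmx_sumr summxE big1 ?mulr0 ?addr0 // => i _.
  rewrite -scalemxAr mxE dual ?(ltnW (ltn_ord i)) // ?gtn_eqF ?mulr0 //.
  exact: leqW.
apply: comaximal_prime => p pp Jp pc pe; have idp := prime_is_ideal pp.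
have pM := idealM idp; have pD := idealD idp.
have pB z w : p (z + w) -> p w -> p z.
  move=> pzw pw; have -> : z = (z + w) + (-1) * w by ring.
  by apply: pD => //; apply: pM.
(* Evaluate phi_k on the new vector, whose coordinates lie in p. *)
have pX : p (x + a ^+ 2 * b).
  have := pc (phi k).
  rewrite mulmx_shift phic' dual // eqxx mulr1n.
  by congr p; ring.
have px : p x.
  suff: p (x * x) by case/(primeM pp).
  apply: (pB _ (a ^+ 2 * (b * x))); last by apply: pM; apply: Jp.
  have -> : x * x + a ^+ 2 * (b * x) = x * (x + a ^+ 2 * b) by ring.
  exact: pM.
have pab : p (a * b).
  suff: p ((a * b) * (a * b)) by case/(primeM pp).
  have -> : a * b * (a * b) = b * (a ^+ 2 * b) by ring.
  by apply: pM; apply: (pB _ x); rewrite // addrC.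
have pc' (w : 'rV_n) : p ((w *m c') 0 0).
  apply: (pB _ (a * b * (w *m g k) 0 0)); last by rewrite mulrC; apply: pM.
  by have := pc w; rewrite mulmx_shift.
have pb : ~ p b.
  move=> pb; apply: (prime_proper pp); rewrite -e1.
  apply: (pD _ _ (pD _ _ (pc' u) (pM _ _ pe)) (pD _ _ _ pb)).
  by rewrite mulrC; apply: pM.
have pa : p a by case/(primeM pp): pab.
apply: (prime_proper pp); have [w [z <-]] := cae.
apply: (pD); last by apply: pM; exact: pD.
apply: (pB _ (a * (w *m \sum_(i < k) t i *: g i) 0 0)).
  by have := pc' w; rewrite mulmx_shift.
by rewrite mulrC; apply: pM.
Qed.

(** * Linear maps and projective modules *)

Section LinearMaps.
Variable A : comPzRingType.

Definition mk_linear (U V : lmodType A) (f : U -> V) (lf : linear f) :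
  {linear U -> V} := HB.pack f (GRing.isLinear.Build A U V *:%R f lf).

Lemma lmod_iso_intro (U V : lmodType A) (f : U -> V) (g : V -> U) :
  linear f -> cancel f g -> cancel g f -> lmod_iso U V.
Proof. by move=> lf fK gK; exists (mk_linear lf), g. Qed.

Lemma lmod_iso_elim (U V : lmodType A) : lmod_iso U V ->
  exists (f : {linear U -> V}) (g : {linear V -> U}), cancel f g /\ cancel g f.
Proof.
move=> [f [g fK gK]]; have lg : linear g.
  by move=> a u v; apply: (can_inj fK); rewrite linearP !gK.
by exists f, (mk_linear lg).
Qed.

Lemma lmod_iso_trans (U V W : lmodType A) :
  lmod_iso U V -> lmod_iso V W -> lmod_iso U W.
Proof.
by move=> [f bf] [g bg]; exists (g \o f : {linear _ -> _}); apply: bij_comp.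
Qed.

Lemma lmod_iso_sym (U V : lmodType A) : lmod_iso U V -> lmod_iso V U.
Proof.
by move=> /lmod_iso_elim[f [g [fK gK]]]; exists g; exists f.
Qed.

Lemma linear_form_row n (f : {linear 'cV[A]_n -> A^o}) :
  exists u : 'rV[A]_n, forall c, (u *m c) 0 0 = f c.
Proof.
exists (\row_i f (delta_mx i 0)) => c.
rewrite [in RHS](matrix_sum_delta c) linear_sum mxE; apply: eq_bigr => i _.
by rewrite big_ord1 linearZ mxE mulrC.
Qed.

Lemma row_linear_form n (u : 'rV[A]_n) :
  linear (fun c : 'cV[A]_n => (u *m c) 0 0 : A^o).
Proof. by move=> a c d; rewrite mulmxDr -scalemxAr !mxE. Qed.

(** The form of finite generation and projectivity used below: a dual basis. *)
Definition free_retract (M : lmodType A) : Prop :=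
  exists n (iota : {linear M -> 'cV[A]_n}) (pi : {linear 'cV[A]_n -> M}),
    cancel iota pi.

Lemma fg_projective_retract (M : lmodType A) : fg_projective M -> free_retract M.
Proof.
move=> [[n [e gen]] projM].
have lf : linear (fun c : 'cV[A]_n => \sum_i c i 0 *: e i).
  move=> a c d; rewrite scaler_sumr -big_split; apply: eq_bigr => i _.
  by rewrite !mxE scalerDl scalerA.
have [|iota iotaK] := projM _ _ (mk_linear lf) (idfun : {linear M -> M}).
  move=> m; have [c ->] := gen m; exists (\col_i c i).
  by apply: eq_bigr => i _; rewrite mxE.
by exists n, iota, (mk_linear lf).
Qed.

End LinearMaps.

(** * Rank and local free summands *)

Section Rank.
Variable A : comPzRingType.

(** Two families dual up to the factor a: after inverting a, they exhibit a free
    summand of M of rank k. They are indexed by all naturals so that an induction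
    on k does not have to change the index type. *)
Definition splits_off (k : nat) (M : lmodType A) (a : A) : Prop :=
  exists (e : nat -> M) (phi : nat -> {linear M -> A^o}),
    forall i j, (i < k)%N -> (j < k)%N -> phi i (e j) = a *+ (i == j).

(** Multiples of elements at which M splits off rank k are again such elements,
    so this says that they generate the unit ideal. *)
Definition locally_splits (k : nat) (M : lmodType A) : Prop :=
  exists2 s : seq A, forall a, a \in s -> splits_off k M a &
    \sum_(a <- s) a = 1.

Lemma splits_offZ k M a b : splits_off k M a -> splits_off k M (b * a).
Proof.
move=> [e [phi dual]]; exists (fun i => b *: e i), phi => i j ik jk.
by rewrite linearZ /= dual // -mulrnAr.
Qed.

Lemma prime_prod (p : A -> Prop) (T : finType) (f : T -> A) :
  is_prime_ideal p -> (forall i, ~ p (f i)) -> ~ p (\prod_i f i).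
Proof.
move=> pp pf; apply: (big_ind (fun x => ~ p x)) => //.
  exact: prime_proper pp.
by move=> x y px py /(primeM pp)[].
Qed.

(** Clear denominators. The generators of M are combinations of the e_i after
    multiplication by some s outside p, so that the coordinates of M in a dual
    basis give forms phi_i with s m = sum_i phi_i(m) e_i. Taking m = e_j, the
    independence of the e_i makes phi_i(e_j) equal to s delta_ij up to a factor t
    outside p, and the t e_j are then dual to the phi_i up to the factor t s. *)
Lemma splits_off_prime k (M : lmodType A) (p : A -> Prop) r :
  free_retract M -> is_prime_ideal p -> rank_at p M r -> (k <= r)%N ->
  exists2 a, ~ p a & splits_off k M a.
Proof.
move=> [n [iota [pi piK]]] pp [e [gen indep]] kr.
have /choice[s0 gen1] (l : 'I_n) : exists s, ~ p s /\
    exists c : 'I_r -> A, s *: pi (delta_mx l 0) = \sum_i c i *: e i.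
  have [s [c [ps ec]]] := gen (pi (delta_mx l 0)).
  by exists s; split=> //; exists c.
have /choice[c0 gen2] l := (gen1 l).2.
pose s := \prod_l s0 l.
have ps : ~ p s by apply: prime_prod => // l; apply: (gen1 l).1.
pose c l i := (\prod_(l' | l' != l) s0 l') * c0 l i.
have genc l : s *: pi (delta_mx l 0) = \sum_i c l i *: e i.
  rewrite /s (bigD1 l) //= mulrC -scalerA gen2 scaler_sumr.
  by apply: eq_bigr => i _; rewrite scalerA.
have lphi i : linear (fun m => \sum_l c l i * iota m l 0 : A^o).
  move=> a u v; rewrite scaler_sumr -big_split; apply: eq_bigr => l _.
  by rewrite linearP !mxE mulrDr mulrCA.
pose phi i := mk_linear (lphi i).
have phiE m : s *: m = \sum_i phi i m *: e i.
  rewrite -{1}[m]piK {1}(matrix_sum_delta (iota m)) linear_sum scaler_sumr.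
  under eq_bigr => l _ do
    rewrite big_ord1 linearZ scalerA mulrC -scalerA genc scaler_sumr.
  rewrite exchange_big; apply: eq_bigr => i _; rewrite /= scaler_suml.
  by apply: eq_bigr => l _; rewrite scalerA mulrC.
have indep1 (ij : 'I_r * 'I_r) : exists t, ~ p t /\
    t * (phi ij.1 (e ij.2) - s *+ (ij.1 == ij.2)) = 0.
  case: ij => i j /=.
  have [|t pt et] := indep (fun i => phi i (e j) - s *+ (i == j)) 1
    (prime_proper pp) _ i; last by exists t.
  rewrite scale1r; under eq_bigr => l _ do rewrite scalerBl.
  rewrite sumrB -phiE [X in _ - X](bigD1 j) //= eqxx mulr1n.
  by rewrite big1 ?addr0 ?subrr // => l /negPf->; rewrite mulr0n scale0r.
have /choice[t0 indep2] := indep1.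
pose t := \prod_ij t0 ij.
have dual i j : t * phi i (e j) = (t * s) *+ (i == j).
  apply/eqP; rewrite -mulrnAr -subr_eq0 -mulrBr /t (bigD1 (i, j)) //=.
  by rewrite mulrAC (indep2 (i, j)).2 mul0r.
exists (t * s).
  by case/(primeM pp) => //; apply: prime_prod => // ij; apply: (indep2 ij).1.
have [r0|r0] := posnP r.
  exists (fun=> 0), (fun=> \0) => i j ik.
  by have := leq_trans ik kr; rewrite r0.
pose o i := insubd (Ordinal r0) i.
exists (fun j => t *: e (o j)), (fun i => phi (o i)) => i j ik jk.
rewrite linearZ [LHS]dual -val_eqE !val_insubd.
by rewrite (leq_trans ik kr) (leq_trans jk kr).
Qed.

Lemma rank_ge_locally_splits k (M : lmodType A) :
  free_retract M -> rank_ge k M -> locally_splits k M.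
Proof.
move=> rM rkM.
pose I x := exists2 s : seq A, (forall a, a \in s -> splits_off k M a)
  & \sum_(a <- s) a = x.
apply: (contrapT (P := I 1)) => I1.
have idI : is_ideal I.
  split.
  - by exists [::] => //; rewrite big_nil.
  - move=> _ _ [s sP <-] [t tP <-]; exists (s ++ t); last by rewrite big_cat.
    by move=> a; rewrite mem_cat => /orP[/sP|/tP].
  - move=> b _ [s sP <-]; exists [seq b * a | a <- s].
      by move=> _ /mapP[a /sP ka ->]; apply: splits_offZ.
    by rewrite big_map mulr_sumr.
have [p [pp _ Ip]] := prime_ideal_exists idI I1.
have [r Mr kr] := rkM p pp.
have [a pa ka] := splits_off_prime rM pp Mr kr.
apply/pa/Ip; exists [:: a]; last by rewrite big_seq1.
by move=> b; rewrite inE => /eqP->.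
Qed.

Lemma locally_splits_prod k (M N : lmodType A) :
  locally_splits k M -> locally_splits k (M * N)%type.
Proof.
move=> [s sP s1]; exists s => // a /sP[e [phi dual]].
exists (fun i => (e i, 0)), (fun i => phi i \o fst : {linear _ -> _}).
exact: dual.
Qed.

End Rank.

(** * Unimodular elements and cancellation of a line *)

Section Bass.
Variable A : comPzRingType.

(** The term a of a decomposition of 1 is removed by perturbing m along the
    elements b e_i, on which the forms are dual up to the factor b a; the
    perturbation is thus a multiple of b. *)
Lemma unimodular_shift k (M : lmodType A) (m : M) (b : A)
    (f : {linear M -> A^o}) (beta : A) :
  Hdim_lt k A -> free_retract M -> locally_splits k M -> f m + beta * b = 1 ->
  exists (w : M) (psi : {linear M -> A^o}), psi (m + b *: w) = 1.
Proof.
move=> hA [n [iota [pi piK]]] [s sP s1] e1.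
have: comaximal (iota m) (b * \sum_(a <- s) a).
  have [u uE] := linear_form_row (f \o pi : {linear _ -> _}).
  by exists u, beta; rewrite uE /= piK s1 mulr1.
have [w] : exists w : M, comaximal (iota m) (b * \sum_(a <- s) a) ->
    comaximal (iota (m + b *: w)) 0.
  (* The decomposition of 1 is consumed from the left; its remaining part, times
     b, plays the part of e in the perturbation lemma. *)
  move: m {f beta e1 s1}; elim: s sP => [|a s IHs] sP m.
    by exists 0; rewrite big_nil mulr0 scaler0 addr0.
  have [e [phi dual]] := sP a (mem_head _ _).
  have /choice[row rowE] i := linear_form_row (phi i \o pi : {linear _ -> _}).
  have [mab|mab] := pselect (comaximal (iota m) (b * a + b * \sum_(a <- s) a));
    last by exists 0; rewrite big_cons mulrDr.
  have [|t] := comaximal_perturb hA (g := fun i => b *: iota (e i)) (phi := row)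
    _ mab.
    move=> i j ik jk; rewrite -scalemxAr mxE rowE /= piK dual //.
    by rewrite mulrnAr.
  pose w := (b * a) *: \sum_(i < k) t i *: e i.
  have -> : iota m + (b * a) *: \sum_(i < k) t i *: (b *: iota (e i))
      = iota (m + b *: w).
    rewrite linearD; congr (_ + _); rewrite !linearZ /= (linear_sum iota).
    rewrite [RHS]scalerA [in RHS]mulrC -[RHS]scalerA.
    congr (_ *: _); rewrite scaler_sumr; apply: eq_bigr => i _.
    by rewrite [in RHS]linearZ /= !scalerA mulrC.
  move=> cw; have [|w' cw'] := IHs _ (m + b *: w).
    by move=> x xs; apply: sP; rewrite inE xs orbT.
  by exists (w + w'); rewrite scalerDr addrA => _; apply: cw'.
move=> /[apply] -[u [v]]; rewrite mulr0 addr0 => ue.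
by exists w, (mk_linear (row_linear_form u) \o iota : {linear _ -> _}).
Qed.

Lemma pair_line (M : lmodType A) (m : M) (b : A^o) :
  (m, b) = (m, 0 : A^o) + (b : A) *: (0 : M, 1 : A^o).
Proof. by congr pair; rewrite /= ?scaler0 ?addr0 // add0r [_ *: _]mulr1. Qed.

Lemma pair0_linear (M L : lmodType A) : linear (fun x : M => (x, 0 : L)).
Proof. by move=> a x y; congr pair; rewrite /= scaler0 addr0. Qed.

(** Divide both sides by the line fixed by h: if h(x, 0) = (y, r), then (y, 0)
    and h(x, 0) differ by a multiple of the fixed vector, so that g(y, 0) has
    first component x. *)
Lemma lmod_iso_drop_line (M N : lmodType A)
    (h : {linear (M * A^o)%type -> (N * A^o)%type})
    (g : {linear (N * A^o)%type -> (M * A^o)%type}) :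
  cancel h g -> cancel g h -> h (0, 1) = (0, 1) -> lmod_iso M N.
Proof.
move=> hK gK h01; have g01 : g (0, 1) = (0, 1) by rewrite -h01 hK.
have aux (U V : lmodType A) (p : {linear (U * A^o)%type -> (V * A^o)%type})
    (q : {linear (V * A^o)%type -> (U * A^o)%type}) :
    cancel p q -> q (0, 1) = (0, 1) ->
  cancel (fun x => (p (x, 0)).1) (fun y => (q (y, 0)).1).
  move=> pK q01 x; have := pK (x, 0); case: (p (x, 0)) => y r /= qyr.
  move: qyr; rewrite pair_line linearD linearZ q01 => /(congr1 fst) /=.
  by rewrite scaler0 addr0.
apply: (@lmod_iso_intro _ _ _ (fun x => (h (x, 0)).1) (fun y => (g (y, 0)).1)).
- by move=> a x y; rewrite pair0_linear linearP.
- exact: aux.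
- exact: aux.
Qed.

Definition shear (M : lmodType A) (w : M) (z : M * A^o) : (M * A^o)%type :=
  (z.1 + z.2 *: w, z.2).

Definition coshear (M : lmodType A) (psi : {linear M -> A^o}) (a : A)
  (z : M * A^o) : (M * A^o)%type := (z.1, z.2 + a * psi z.1).

Lemma shear_linear (M : lmodType A) (w : M) : linear (shear w).
Proof.
move=> a [x r] [y s]; congr pair; rewrite /= scalerDr scalerDl scalerA.
by rewrite !addrA; congr (_ + _); rewrite -!addrA; congr (_ + _); rewrite addrC.
Qed.

Lemma shearK (M : lmodType A) (w : M) : cancel (shear w) (shear (- w)).
Proof. by case=> x r; congr pair; rewrite /= scalerN addrK. Qed.

Lemma shearVK (M : lmodType A) (w : M) : cancel (shear (- w)) (shear w).
Proof. by move=> z; rewrite -{1}[w]opprK shearK. Qed.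

Lemma coshear_linear (M : lmodType A) psi a : linear (@coshear M psi a).
Proof.
move=> b [x r] [y s]; congr pair; rewrite /= linearP.
by rewrite -[b *: r]/(b * r) -[b *: psi x]/(b * psi x)
  -[b *: (r + _)]/(b * (r + a * psi x)); ring.
Qed.

Lemma coshearK (M : lmodType A) psi a :
  cancel (@coshear M psi a) (coshear psi (- a)).
Proof. by case=> x r; congr pair; rewrite /= mulNr addrK. Qed.

Lemma coshearVK (M : lmodType A) psi a :
  cancel (@coshear M psi (- a)) (coshear psi a).
Proof. by move=> z; rewrite -{1}[a]opprK coshearK. Qed.

(** Elementary operations bring (m, b) to (0, 1): with v = m + b w and
    psi(v) = 1, the steps are (m, b) to (v, b) to (v, 1) to (0, 1). *)
Lemma cancel_line k (M N : lmodType A) :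
  Hdim_lt k A -> free_retract M -> locally_splits k M ->
  lmod_iso (M * A^o)%type (N * A^o)%type -> lmod_iso M N.
Proof.
move=> hA rM sM /lmod_iso_elim[f [g [fK gK]]].
case gE : (g (0, 1)) => [m b].
have lf0 : linear (fun x => (f (x, 0)).2).
  by move=> a x y; rewrite pair0_linear linearP.
have e1 : mk_linear lf0 m + (f (0, 1)).2 * b = 1.
  have := gK (0, 1); rewrite gE.
  by rewrite pair_line linearD linearZ mulrC => /(congr1 snd).
have [w [psi psi1]] := unimodular_shift hA rM sM e1.
pose v := m + b *: w.
pose sw := mk_linear (shear_linear w); pose sw' := mk_linear (shear_linear (- w)).
pose sv := mk_linear (shear_linear (- v)); pose sv' := mk_linear (shear_linear v).
pose sp := mk_linear (coshear_linear psi (1 - b)).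
pose sp' := mk_linear (coshear_linear psi (- (1 - b))).
have theta_mb : sv (sp (sw (m, b))) = (0, 1).
  rewrite /= /coshear /shear /= psi1 mulr1 [b + _]addrC subrK.
  by rewrite scale1r subrr.
apply: (@lmod_iso_drop_line _ _ (f \o (sw' \o (sp' \o sv')) : {linear _ -> _})
  (sv \o (sp \o (sw \o g)) : {linear _ -> _})).
- by move=> z /=; rewrite fK shearVK coshearVK shearK.
- by move=> z /=; rewrite shearVK coshearK shearK gK.
- by rewrite -theta_mb /= shearVK coshearK shearK -gE gK.
Qed.

End Bass.

(** * Cancellation of projective modules *)

Section Cancellation.
Variable A : comPzRingType.

Lemma col_mx_top n (r : A) (u : 'cV[A]_n) : (col_mx r%:M u : 'cV_(1 + n)) 0 0 = r.
Proof.
have -> : 0 = lshift n 0 :> 'I_(1 + n) by apply: val_inj.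
by rewrite col_mxEu mxE.
Qed.

Lemma free_retract_line (M : lmodType A) :
  free_retract M -> free_retract (M * A^o)%type.
Proof.
move=> [n [iota [pi piK]]].
have li : linear (fun z : M * A^o => col_mx (z.2 : A)%:M (iota z.1) : 'cV_(1 + n)).
  move=> a [x r] [y s] /=; rewrite scale_col_mx add_col_mx linearP.
  by congr col_mx; apply/matrixP => i j; rewrite !ord1 !mxE.
have lp : linear (fun c : 'cV_(1 + n) => (pi (dsubmx c), c 0 0 : A^o)).
  by move=> a c d; congr pair; rewrite /= ?mxE // !linearP.
exists (1 + n)%N, (mk_linear li), (mk_linear lp) => -[x r] /=.
rewrite col_mxKd piK; congr pair.
exact: col_mx_top.
Qed.

Lemma lmod_iso_cV_recl (M : lmodType A) q :
  lmod_iso (M * 'cV[A]_q.+1)%type ((M * A^o) * 'cV[A]_q)%type.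
Proof.
pose f (z : M * 'cV[A]_q.+1) : ((M * A^o) * 'cV[A]_q)%type :=
  ((z.1, z.2 0 0), dsubmx (z.2 : 'cV_(1 + q))).
pose g (z : (M * A^o) * 'cV[A]_q) : (M * 'cV[A]_q.+1)%type :=
  (z.1.1, col_mx (z.1.2 : A)%:M z.2).
apply: (@lmod_iso_intro _ _ _ f g); rewrite /f /g.
- by move=> a [x u] [y v] /=; rewrite !mxE linearP.
- move=> [x u] /=; congr pair.
  rewrite -[RHS](@vsubmxK _ 1 q); congr (@col_mx _ 1 q 1 _ _).
  by rewrite [RHS]mx11_scalar !mxE; congr (u _ _)%:M; apply: val_inj.
- move=> [[x r] u] /=; rewrite col_mxKd; congr (_, _, _).
  exact: col_mx_top.
Qed.

Lemma cancel_free k q : forall M N : lmodType A,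
  Hdim_lt k A -> free_retract M -> locally_splits k M ->
  lmod_iso (M * 'cV[A]_q)%type (N * 'cV[A]_q)%type -> lmod_iso M N.
Proof.
elim: q => [|q IHq] M N hA rM sM isoMN.
  have drop0 (U : lmodType A) : lmod_iso (U * 'cV[A]_0)%type U.
    apply: (@lmod_iso_intro _ _ _ fst (fun x => (x, 0))) => // -[x u] /=.
    by rewrite [u]flatmx0 [in LHS]flatmx0.
  exact: lmod_iso_trans (lmod_iso_sym (drop0 M)) (lmod_iso_trans isoMN (drop0 N)).
apply: (cancel_line hA rM sM).
apply: IHq => //; [exact: free_retract_line|exact: locally_splits_prod|].
apply: lmod_iso_trans (lmod_iso_sym (lmod_iso_cV_recl M q)) _.
exact: lmod_iso_trans isoMN (lmod_iso_cV_recl N q).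
Qed.

(** Write u in A^q as iota(pi(u)) plus a vector in the kernel of pi, and let the
    isomorphism act on the first part only. This avoids naming a complement
    of Q. *)
Lemma lmod_iso_free (M N Q : lmodType A) q (iota : {linear Q -> 'cV[A]_q})
    (pi : {linear 'cV[A]_q -> Q}) :
  cancel iota pi -> lmod_iso (M * Q)%type (N * Q)%type ->
  lmod_iso (M * 'cV[A]_q)%type (N * 'cV[A]_q)%type.
Proof.
move=> piK /lmod_iso_elim[f [g [fK gK]]].
pose ext (U V : lmodType A) (p : U * Q -> V * Q) (z : U * 'cV[A]_q)
    : (V * 'cV[A]_q)%type :=
  let y := p (z.1, pi z.2) in (y.1, iota y.2 + (z.2 - iota (pi z.2))).
have extK (U V : lmodType A) (p : U * Q -> V * Q) (p' : V * Q -> U * Q) :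
    cancel p p' -> cancel (ext _ _ p) (ext _ _ p').
  move=> pK [x u]; rewrite /ext /=.
  case pE: (p (x, pi u)) => [y c] /=.
  rewrite linearD linearB !piK subrr addr0 -pE pK /=.
  by rewrite [iota c + _]addrC addrK addrC subrK.
apply: (@lmod_iso_intro _ _ _ (ext _ _ f) (ext _ _ g));
  [|exact: extK|exact: extK].
move=> a [x u] [y v]; rewrite /ext /=.
have -> : (a *: x + y, pi (a *: u + v)) = a *: (x, pi u) + (y, pi v).
  by rewrite linearP.
rewrite linearP; congr pair => /=.
rewrite !linearP /= !scalerDr [RHS]addrACA; congr (_ + _).
exact: addrACA.
Qed.

End Cancellation.

Theorem mainTheorem8 (A : comPzRingType) (k : nat) (M N Q : lmodType A)
    (hA : Hdim_lt k A)
    (hM : fg_projective M) (hMk : rank_ge k M)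
    (hN : fg_projective N) (hQ : fg_projective Q) :
  lmod_iso (M * Q)%type (N * Q)%type -> lmod_iso M N.
Proof.
move=> isoMN; have [q [iota [pi piK]]] := fg_projective_retract hQ.
have rM := fg_projective_retract hM.
apply: (cancel_free hA rM (rank_ge_locally_splits rM hMk)).
exact: lmod_iso_free piK isoMN.
Qed.
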